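(* Let $\sigma(x)=\sin(x)$. Then for all $\mu\in\mathbb R$ and $\nu\ge0$, $$M_\sigma(\mu;\nu)=e^{-\nu/2}\sin(\mu).$$
   Context: $M_\sigma(\mu;\nu):=\mathbb E\,\sigma(X)$ where $X\sim\mathcal N(\mu,\nu)$ ($\nu$ is the variance). *)

(* Defs.v *)
From HB Require Import structures.
From mathcomp Require Import all_boot all_order all_algebra.
From mathcomp Require Import all_classical all_reals all_analysis.
From mathcomp Require Import measurable_realfun.

Set Implicit Arguments.
Unset Strict Implicit.
Unset Printing Implicit Defensive.

Import Order.TTheory GRing.Theory Num.Theory.
Import numFieldNormedType.Exports.

Local Open Scope classical_set_scope.
Local Open Scope ring_scope.

(* The Gaussian law N(mu, nu), where nu >= 0 is the variance and N(mu, 0) is the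
   point mass at mu.  The library's [normal_prob m s] is parametrized by the
   standard deviation s, and at s = 0 it is by convention the uniform law on
   [0, 1], so the degenerate case has to be separated. *)
Definition gaussian {R : realType} (mu nu : R) :
    probability (measurableTypeR R) R :=
  if nu == 0 then [the probability _ _ of @dirac _ (measurableTypeR R) mu R]
  else [the probability _ _ of normal_prob mu (Num.sqrt nu)].

(* E[sigma(X)] for X ~ N(mu, nu), with X taken to be the identity on the
   probability space (R, N(mu, nu)); by [gaussian_meanE] any other choice of X
   gives the same value. *)
Definition gaussian_mean {R : realType} (sigma : R -> R) (mu nu : R) : \bar R :=
  ('E_(gaussian mu nu)[sigma])%E.

Lemma gaussian_meanE (d : measure_display) (T : measurableType d)
    (R : realType) (P : probability T R) (X : {RV P >-> measurableTypeR R})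
    (sigma : R -> R) (mu nu : R) :
  measurable_fun [set: R] sigma ->
  (forall A, measurable A -> distribution P X A = gaussian mu nu A) ->
  ('E_P[sigma \o X] = gaussian_mean sigma mu nu)%E.
Proof.
move=> msigma XN; rewrite /gaussian_mean !unlock.
have mE : measurable_fun [set: R] (EFin \o sigma) by exact/measurable_EFinP.
transitivity (\int[distribution P X]_x (sigma x)%:E)%E; last first.
  by apply: eq_measure_integral => A mA _; exact: XN.
rewrite [LHS]integralE [RHS]integralE; congr (_ - _)%E.
- rewrite ge0_integral_distribution//; last exact: measurable_funepos.
  under eq_integral do rewrite funeposE.
  by under [RHS]eq_integral do rewrite /= funeposE.
- rewrite ge0_integral_distribution//; last exact: measurable_funeneg.
  under eq_integral do rewrite funenegE.
  by under [RHS]eq_integral do rewrite /= funenegE.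
Qed.

(* Main.v *)
Require Import Defs.
From HB Require Import structures.
From mathcomp Require Import all_boot all_order all_algebra.
From mathcomp Require Import all_classical all_reals all_analysis.
From mathcomp Require Import measurable_realfun.
From mathcomp Require Import ring lra.

Import Order.TTheory GRing.Theory Num.Theory.
Import numFieldNormedType.Exports.

Local Open Scope ring_scope.

(** Write p for the density of N(mu, s^2) with s != 0.  The function
    g(t, x) = exp(s^2 t^2 / 2) sin(mu + t (x - mu)) p(x) satisfies
    dg/dt = d/dx [- s^2 exp(s^2 t^2 / 2) cos(mu + t (x - mu)) p(x)], because
    p'(x) = - (x - mu) / s^2 p(x).  The bracket vanishes at infinity, so the
    integral of g(t, .) does not depend on t; it is sin mu at t = 0 and
    exp(s^2 / 2) E[sin X] at t = 1. *)

Local Open Scope classical_set_scope.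

(** * Integration over the whole line: an improper fundamental theorem of calculus, and integration
    against the normal density *)

Lemma integralT_continuous_FTC2 {R : realType} (f F : R -> R) (l r : R) :
  continuous f -> lebesgue_measure.-integrable [set: R] (EFin \o f) ->
  (forall x : R, is_derive x 1 F (f x)) ->
  F x @[x --> -oo] --> l -> F x @[x --> +oo] --> r ->
  (\int[lebesgue_measure]_x (f x)%:E = (r - l)%:E)%E.
Proof.
move=> cf intf dF Fl Fr.
(* Symmetric truncation: [f_ n] tends to [f] pointwise and is dominated by the absolute value of
   [f], so dominated convergence reduces the claim to compact intervals. The index [n.+1] keeps the
   two endpoints distinct, as [continuous_FTC2] requires. *)
pose I n : set R := `[- n.+1%:R, n.+1%:R].
pose f_ n := (EFin \o f) \_ (I n).
have mI n : measurable (I n) by exact: measurable_itv.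
have mf : measurable_fun setT (EFin \o f) by exact: measurable_int intf.
have f_f x : f_ n x @[n --> \oo] --> (f x)%:E.
  apply: cvg_near_cst; exists (Num.truncn `|x|).+1 => // n /= xn.
  rewrite /f_ patchE mem_set// /I/= in_itv/= -ler_norml.
  rewrite (le_trans (ltW (truncnS_gt _)))// ler_nat.
  by rewrite (leq_trans xn).
have [] := @dominated_convergence _ _ R lebesgue_measure setT measurableT f_
  (EFin \o f) (abse \o (EFin \o f)) _ mf _ _ _.
- by move=> n; apply/(measurable_restrictT _ (mI n)); exact: measurable_funTS.
- by apply: aeW => x _; exact: f_f.
- exact: integrable_abse.
- apply: aeW => x n _; rewrite /f_ patchE; case: ifPn => // _.
  by rewrite abse0 abse_ge0.
move=> _ _ intcvg; apply/esym/(cvg_unique _ _ intcvg) => //.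
have n1y : (n.+1%:R : R) @[n --> \oo] --> +oo.
  apply: (@cvg_comp _ _ _ S (fun n => n%:R : R) _ _ _ _ cvgr_idn).
  exact: (cvg_addnl 1).
have Fcont (x : R) : {for x, continuous F}.
  by apply/differentiable_continuous/derivable1_diffP; exact: ex_derive.
suff -> : [sequence (\int[lebesgue_measure]_x f_ n x)%E]_n =
    (fun n => (F n.+1%:R - F (- n.+1%:R))%:E).
  apply: cvg_EFin; first exact: nearW.
  apply: cvgB.
    by move/cvg_pinftyP : Fr; exact.
  move/cvg_ninftyP : Fl; apply; apply/cvgNry.
  rewrite (_ : - _ = (fun n => n.+1%:R)); last first.
    by apply/funext => n; rewrite fctE opprK.
  exact: n1y.
apply/funext => n /=.
rewrite /f_ -integral_mkcond (@continuous_FTC2 _ f F)//.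
- by rewrite (@lt_trans _ _ 0)// ?oppr_lt0.
- exact: continuous_subspaceT.
- split => [x _||]; first exact: ex_derive.
  + exact/cvg_at_right_filter/Fcont.
  + exact/cvg_at_left_filter/Fcont.
- by move=> x _; rewrite derive1E; exact: derive_val.
Qed.

(** Change of variables holds with the Radon-Nikodym derivative; that derivative agrees almost
    everywhere with [normal_pdf], since both have the same integral over every measurable set. *)
Lemma integral_normal_prob {R : realType} (m s : R) (f : R -> \bar R) :
  (normal_prob m s).-integrable [set: measurableTypeR R] f ->
  (\int[normal_prob m s]_x f x =
   \int[lebesgue_measure]_x (f x * (normal_pdf m s x)%:E))%E.
Proof.
move=> intf; have mf := measurable_int _ intf.
have dom := normal_prob_dominates m s.
rewrite -(Radon_Nikodym_change_of_variables dom)//=.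
apply: ae_eq_integral => //.
- exact: emeasurable_funM.
- apply: emeasurable_funM => //; apply/measurable_EFinP.
  exact: measurable_normal_pdf.
- apply: ae_eqe_mul2l => /=; apply: integral_ae_eq => //=.
  + exact: Radon_Nikodym_integrable.
  + by apply/measurable_EFinP; exact: measurable_normal_pdf.
  + by move=> E _ mE; rewrite -Radon_Nikodym_integral.
Qed.

(** * Derivative, decay and first absolute moment of the normal density *)

Lemma is_derive_normal_pdf {R : realType} (m s x : R) : s != 0 ->
  is_derive x 1 (normal_pdf m s) (- ((x - m) / s ^+ 2) * normal_pdf m s x).
Proof.
move=> s0.
have -> : normal_pdf m s =
    (fun y => normal_peak s * expR (- (y - m) ^+ 2 / (s ^+ 2 *+ 2))).
  by rewrite normal_pdfE.
by apply: trigger_derive; rewrite /GRing.scale/=; field.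
Qed.

Lemma normal_pdf_cvgy {R : realType} (m s : R) : s != 0 ->
  normal_pdf m s x @[x --> +oo] --> 0.
Proof.
move=> s0; rewrite normal_pdfE// -[X in _ --> X](mulr0 (normal_peak s)).
apply: cvgM; first exact: cvg_cst.
rewrite /normal_fun.
under eq_cvg do rewrite mulNr.
apply: (@cvg_comp _ _ _ (fun x => (x - m) ^+ 2 / (s ^+ 2 *+ 2))
  (fun x => expR (- x))); last exact: cvgr_expR.
have ss : 0 < s ^+ 2 *+ 2 by rewrite pmulrn_lgt0// lt0r sqrf_eq0 s0 sqr_ge0.
apply/cvgryPge => A; near=> x.
rewrite ler_pdivlMr//.
(* Once [x - m] is at least 1, its square dominates it, so a linear lower bound suffices. *)
have x1 : 1 <= x - m.
  by rewrite lerBrDr; near: x; apply: nbhs_pinfty_ge; exact: num_real.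
have xA : A * (s ^+ 2 *+ 2) <= x - m.
  by rewrite lerBrDr; near: x; apply: nbhs_pinfty_ge; exact: num_real.
by rewrite (le_trans xA)// expr2 ler_peMl// (le_trans ler01).
Unshelve. all: end_near. Qed.

Lemma normal_pdf_sym {R : realType} (m s x : R) : s != 0 ->
  normal_pdf m s (- x) = normal_pdf (- m) s x.
Proof.
move=> s0; rewrite !normal_pdfE// /normal_fun.
by rewrite -opprD sqrrN opprK.
Qed.

Lemma normal_pdf_cvgNy {R : realType} (m s : R) : s != 0 ->
  normal_pdf m s x @[x --> -oo] --> 0.
Proof.
move=> s0; apply/cvgNy_compNP.
rewrite (_ : _ \o _ = normal_pdf (- m) s); first exact: normal_pdf_cvgy.
by apply/funext => x /=; exact: normal_pdf_sym.
Qed.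

(** The linear factor is absorbed by half of the Gaussian exponent. What remains is a multiple of
    the normal density with doubled variance, which is integrable; [C] collects the ratio of the two
    peaks and the constant of the absorption. *)
Lemma integrable_norm_normal_pdf {R : realType} (m s : R) : s != 0 ->
  lebesgue_measure.-integrable [set: R]
    (fun x => (`|x - m| * normal_pdf m s x)%:E).
Proof.
move=> s0; pose s' := Num.sqrt 2 * s.
have s'0 : s' != 0 by rewrite mulf_neq0// gt_eqF// sqrtr_gt0.
have ss' : s' ^+ 2 = s ^+ 2 *+ 2 by rewrite exprMn sqr_sqrtr// mulr_natl.
have ss : 0 < s ^+ 2 by rewrite lt0r sqrf_eq0 s0 sqr_ge0.
pose C := (s ^+ 2 + 1) * normal_peak s / normal_peak s'.
have intC : lebesgue_measure.-integrable [set: R]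
    (fun x => (C * normal_pdf m s' x)%:E).
  under eq_fun do rewrite EFinM.
  by apply: integrableZl => //; exact: integrable_normal_pdf.
apply: (le_integrable _ _ _ intC) => //.
- apply/measurable_EFinP/measurable_funM; last exact: measurable_normal_pdf.
  by apply: measurableT_comp => //; exact: measurable_funB.
- move=> x _; rewrite !abse_EFin lee_fin.
  have C0 : 0 <= C.
    by rewrite !mulr_ge0 ?invr_ge0 ?normal_peak_ge0// addr_ge0// sqr_ge0.
  rewrite normrM normr_id (ger0_norm (normal_pdf_ge0 m s x)).
  rewrite (ger0_norm (mulr_ge0 C0 (normal_pdf_ge0 m s' x))).
  rewrite !normal_pdfE// /C /normal_fun ss'.
  rewrite [leRHS]mulrA divfK ?gt_eqF ?normal_peak_gt0//.
  rewrite [leLHS]mulrCA (mulrC (s ^+ 2 + 1)) -mulrA.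
  rewrite ler_wpM2l ?normal_peak_ge0//.
  (* The original exponent is [- u - u] and that of the wider density is [- u], so it remains to
     bound [|x - m|] by [(s ^+ 2 + 1) * expR u]. *)
  pose u := (x - m) ^+ 2 / (s ^+ 2 *+ 4).
  have u0 : 0 <= u by rewrite mulr_ge0 ?sqr_ge0// invr_ge0 mulrn_wge0// ltW.
  have -> : - (x - m) ^+ 2 / (s ^+ 2 *+ 2) = - u - u by rewrite /u; field.
  have -> : - (x - m) ^+ 2 / (s ^+ 2 *+ 2 *+ 2) = - u by rewrite /u; field.
  rewrite expRD mulrA ler_wpM2r ?expR_ge0// expRN ler_pdivrMr ?expR_gt0//.
  apply: (@le_trans _ _ ((s ^+ 2 + 1) * (1 + u))); last first.
    by rewrite ler_wpM2l ?addr_ge0 ?sqr_ge0// expR_ge1Dx.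
  (* Arithmetic-geometric mean inequality, the difference being an explicit square. *)
  have AG : `|x - m| <= s ^+ 2 + u.
    rewrite -subr_ge0.
    have -> : s ^+ 2 + u - `|x - m| = (s - `|x - m| / (s *+ 2)) ^+ 2.
      by rewrite /u -(real_normK (num_real (x - m))); field.
    exact: sqr_ge0.
  by apply: (le_trans AG); nra.
Qed.

(** * The tilted sine and the constancy of its integral in [t] *)

Section tilted_sine.
Context {R : realType} (m s : R).
Hypothesis s0 : s != 0.

Let g (t x : R) :=
  expR (s ^+ 2 * t ^+ 2 / 2) * sin (m + t * (x - m)) * normal_pdf m s x.

Let dg (t x : R) := expR (s ^+ 2 * t ^+ 2 / 2) *
  (s ^+ 2 * t * sin (m + t * (x - m)) + (x - m) * cos (m + t * (x - m))) *
  normal_pdf m s x.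

Let G (t x : R) :=
  - (s ^+ 2 * expR (s ^+ 2 * t ^+ 2 / 2)) *
  (cos (m + t * (x - m)) * normal_pdf m s x).

Let is_derive_g (t x : R) : is_derive t 1 (g ^~ x) (dg t x).
Proof.
rewrite /g /dg; apply: trigger_derive; rewrite /GRing.scale/=.
by field.
Qed.

Let is_derive_G (t x : R) : is_derive x 1 (G t) (dg t x).
Proof.
(* With [dp] in context, instance resolution can differentiate the density. The factor [s ^+ 2] of
   [G] cancels the denominator in the derivative of the density. *)
have dp := is_derive_normal_pdf m s x s0.
rewrite /G /dg; apply: trigger_derive; rewrite /GRing.scale/=.
by field.
Qed.

(** This envelope serves every domination below: [d = 0] suffices for [g], while differentiating in
    [t] brings out a factor [x - m]. *)
Let integrable_bound (c d : R) :
  lebesgue_measure.-integrable [set: R]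
    (EFin \o (fun x => (c + d * `|x - m|) * normal_pdf m s x)).
Proof.
have -> : EFin \o (fun x => (c + d * `|x - m|) * normal_pdf m s x) =
    (fun x => c%:E * (normal_pdf m s x)%:E +
              d%:E * (`|x - m| * normal_pdf m s x)%:E)%E.
  by apply/funext => x; rewrite /= -!EFinM -EFinD mulrDl mulrA.
apply: integrableD => //; apply: integrableZl => //.
- exact: integrable_normal_pdf.
- exact: integrable_norm_normal_pdf.
Qed.

(** The bound depends on [T] only, hence is uniform in [t], as differentiation under the integral
    demands. Taking [T] to be the absolute value of [t] gives integrability for fixed [t]. *)
Let dg_le (t T x : R) : `|t| <= T ->
  `|dg t x| <=
  (expR (s ^+ 2 * T ^+ 2 / 2) * (s ^+ 2 * T) +
   expR (s ^+ 2 * T ^+ 2 / 2) * `|x - m|) * normal_pdf m s x.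
Proof.
move=> tT; have T0 : 0 <= T by exact: le_trans tT.
rewrite /dg normrM (ger0_norm (normal_pdf_ge0 m s x)).
rewrite ler_wpM2r ?normal_pdf_ge0// -mulrDr normrM.
apply: ler_pM => //.
  rewrite ger0_norm ?expR_ge0// ler_expR ler_wpM2r//.
  by rewrite ler_wpM2l ?sqr_ge0// -(real_normK (num_real t)) lerXn2r// nnegrE.
rewrite (le_trans (ler_normD _ _))// lerD//.
  rewrite normrM normrM (ger0_norm (sqr_ge0 s)) -[leRHS]mulr1.
  by apply: ler_pM => //; [rewrite mulr_ge0// sqr_ge0|
    rewrite ler_wpM2l// sqr_ge0|exact: sin_max].
by rewrite normrM ler_piMr//; exact: cos_max.
Qed.

Let continuous_dg (t : R) : continuous (dg t).
Proof.
move=> x; have dp := is_derive_normal_pdf m s x s0.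
by apply/differentiable_continuous/derivable1_diffP/ex_derive.
Qed.

Let integrable_dg (t : R) :
  lebesgue_measure.-integrable [set: R] (EFin \o dg t).
Proof.
apply: (le_integrable _ _ _ (integrable_bound _ _)) => //.
  by apply/measurable_EFinP; exact: continuous_measurable_fun (continuous_dg t).
move=> x _; rewrite lee_fin.
exact: (le_trans (dg_le t `|t| x (lexx _)) (ler_norm _)).
Qed.

Let continuous_g (t : R) : continuous (g t).
Proof.
move=> x; have dp := is_derive_normal_pdf m s x s0.
by apply/differentiable_continuous/derivable1_diffP/ex_derive.
Qed.

Let integrable_g (t : R) :
  lebesgue_measure.-integrable [set: R] (EFin \o g t).
Proof.
apply: (le_integrable _ _ _
  (integrable_bound (expR (s ^+ 2 * t ^+ 2 / 2)) 0)) => //.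
  by apply/measurable_EFinP; exact: continuous_measurable_fun (continuous_g t).
move=> x _; rewrite lee_fin mul0r addr0 !normrM ler_wpM2r//.
by rewrite ler_piMr//; exact: sin_max.
Qed.

(** The cosine is bounded, so [G t] vanishes wherever the density does; an arbitrary filter covers
    both infinities at once. *)
Let G_cvg0 (F : set_system R) : Filter F ->
  normal_pdf m s x @[x --> F] --> 0 -> forall t, G t x @[x --> F] --> 0.
Proof.
move=> FF p0 t.
rewrite -[X in _ --> X](mulr0 (- (s ^+ 2 * expR (s ^+ 2 * t ^+ 2 / 2)))).
apply: cvgM; first exact: cvg_cst.
apply: norm_cvg0.
apply: (@squeeze_cvgr _ _ _ _ (cst 0) (normal_pdf m s)) => //;
  last exact: cvg_cst.
apply: nearW => x /=.
rewrite normr_ge0/= normrM (ger0_norm (normal_pdf_ge0 m s x)).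
by rewrite ler_piMl ?normal_pdf_ge0//; exact: cos_max.
Qed.

Let integral_dg (t : R) : (\int[lebesgue_measure]_x (dg t x)%:E = 0)%E.
Proof.
rewrite (_ : 0%E = (0 - 0)%:E); last by rewrite subrr.
apply: (@integralT_continuous_FTC2 R (dg t) (G t) 0 0).
- exact: continuous_dg.
- exact: integrable_dg.
- exact: is_derive_G.
- by apply: G_cvg0; exact: normal_pdf_cvgNy.
- by apply: G_cvg0; exact: normal_pdf_cvgy.
Qed.

Let h (t : R) : R := \int[lebesgue_measure]_x g t x.

Let is_derive_h (t : R) : is_derive t 1 h 0.
Proof.
have d1g u x : partial1of2 g u x = dg u x.
  by rewrite partial1of2E; exact: derive_val.
(* Domination is only needed near [t]: every [u] in the open interval of radius 1 around [t] has
   absolute value at most [T]. *)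
pose T := `|t| + 1.
have It : `]t - 1, t + 1[%classic t by rewrite /= in_itv/=; lra.
pose B x := (expR (s ^+ 2 * T ^+ 2 / 2) * (s ^+ 2 * T) +
  expR (s ^+ 2 * T ^+ 2 / 2) * `|x - m|) * normal_pdf m s x.
have B0 x : 0 <= B x.
  rewrite mulr_ge0 ?normal_pdf_ge0//.
  have T0 : 0 <= T by rewrite addr_ge0.
  by rewrite addr_ge0// mulr_ge0 ?expR_ge0// mulr_ge0 ?sqr_ge0.
have gB u x : `]t - 1, t + 1[%classic u -> setT x ->
    `|partial1of2 g u x| <= B x.
  rewrite /= in_itv/= => /andP[u1 u2] _; rewrite d1g; apply: dg_le.
  rewrite ler_norml /T; have := ler_norm t; have := ler_norm (- t).
  by rewrite normrN; move=> ? ?; apply/andP; split; lra.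
have ig u : `]t - 1, t + 1[%classic u ->
    lebesgue_measure.-integrable [set: R] (EFin \o g u) by [].
have dg' u x : `]t - 1, t + 1[%classic u -> setT x -> derivable (g ^~ x) u 1.
  by move=> _ _; exact: ex_derive.
(* Derivability of [h] and the value of its derivative are separate obligations, both met by the
   same domination data; the value is the integral of [dg t], which is zero. *)
apply: DeriveDef.
  exact: (derivable_under_integral measurableT It ig dg' B0
    (integrable_bound _ _) gB).
rewrite -derive1E.
rewrite (differentiation_under_integral measurableT It ig dg' B0
  (integrable_bound _ _) gB).
under eq_Rintegral do rewrite d1g.
by rewrite /Rintegral integral_dg.
Qed.

Lemma integral_sin_normal_pdf :
  (\int[lebesgue_measure]_x (sin x * normal_pdf m s x)%:E =
   (expR (- s ^+ 2 / 2) * sin m)%:E)%E.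
Proof.
have h0 : h 0 = sin m.
  rewrite /h /Rintegral.
  under eq_integral do
    rewrite /g expr0n/= mulr0 !mul0r expR0 mul1r addr0 EFinM.
  rewrite integralZl//; last exact: integrable_normal_pdf.
  by rewrite integral_normal_pdf mule1.
have h1 : h 1 = sin m by rewrite -h0; exact: is_derive_0_is_cst.
(* At [t = 1] the argument of the sine is [x], and the prefactor inverts the exponential in
   [g 1]. *)
transitivity (\int[lebesgue_measure]_x
    ((expR (- s ^+ 2 / 2))%:E * (g 1 x)%:E))%E.
  apply: eq_integral => x _; rewrite /g -EFinM expr1n mulr1 mul1r subrKC.
  by rewrite !mulrA -expRD mulNr addNr expR0 mul1r.
rewrite integralZl//; last exact: integrable_g.
rewrite EFinM; congr (_ * _)%E.
(* [h 1] is the [fine] of an extended integral, so recovering that integral requires its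
   finiteness. *)
rewrite -h1 /h /Rintegral fineK//.
by apply: integrable_fin_num => //; exact: integrable_g.
Qed.

End tilted_sine.

Theorem lemmaG1 (R : realType) (mu nu : R) (nu_ge0 : 0 <= nu) :
  gaussian_mean sin mu nu = (expR (- nu / 2) * sin mu)%:E.
Proof.
have msin : measurable_fun [set: R] (@sin R).
  by apply: continuous_measurable_fun; exact: continuous_sin.
rewrite /gaussian_mean unlock /gaussian.
(* For zero variance the law is a point mass and the exponential factor is 1. *)
have [->|nu0] := eqVneq nu 0.
  rewrite integral_dirac//; last exact/measurable_EFinP.
  by rewrite diracT mul1e oppr0 mul0r expR0 mul1r.
have s0 : Num.sqrt nu != 0 by rewrite sqrtr_eq0 -ltNge lt_def nu0.
rewrite /= integral_normal_prob.
  under eq_integral do rewrite /= -EFinM.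
  by rewrite integral_sin_normal_pdf// sqr_sqrtr.
(* Integrability of the sine under the normal law: it is bounded by 1 and the measure is finite. *)
apply: (@le_integrable _ _ _ _ _ measurableT _ (cst 1%E)).
- exact/measurable_EFinP.
- by move=> x _ /=; rewrite lee_fin normr1; exact: sin_max.
- exact: finite_measure_integrable_cst.
Qed.
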